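(* Let $a=(a_k)_{k\ge1}$ be a sequence of complex numbers with $a_1=0$. For integers $k>l\ge0$ let $P_{(k,l);a}$ be the multiparameter Schur P-function of the strict partition $(k,l)$ (which is $(k)$ if $l=0$), and for $0\le k\le l$ put $P_{(k,l);a}=-P_{(l,k);a}$. Then $$4uv(u+v)\sum_{k,l\ge0}\frac{P_{(k,l);a}(x_1,x_2,\dots)}{(u\mid a)^{k+1}(v\mid a)^{l+1}}=u\Bigl(\prod_{j\ge1}\frac{u+x_j}{u-x_j}+1\Bigr)\Bigl(-\prod_{j\ge1}\frac{v+x_j}{v-x_j}+1\Bigr)-v\Bigl(-\prod_{j\ge1}\frac{u+x_j}{u-x_j}+1\Bigr)\Bigl(\prod_{j\ge1}\frac{v+x_j}{v-x_j}+1\Bigr),$$ as an identity of formal power series in $u^{-1},v^{-1}$ (with finitely many positive powers) with coefficients in $\Gamma$ (equivalently, for every $n$, after setting $x_j=0$ for $j>n$).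
   Context: $\Gamma$ is the algebra of supersymmetric functions: sequences $(f_m)_{m\ge1}$ of supersymmetric polynomials (symmetric, and independent of $t$ after substituting $x_i=t,x_j=-t$) with $f_{m+1}(x_1,\dots,x_m,0)=f_m$ and bounded degrees. Put $(x\mid a)^k=\prod_{m=1}^k(x-a_m)$, $(x\mid a)^0=1$. For a strict partition $\lambda=(\lambda_1>\dots>\lambda_l>0)$ and $m\ge l$, $$P_{\lambda;a}(x_1,\dots,x_m)=\frac1{(m-l)!}\sum_{\omega\in S(m)}\prod_{i=1}^l (x_{\omega(i)}\mid a)^{\lambda_i}\prod_{1\le i\le l,\ i<j\le m}\frac{x_{\omega(i)}+x_{\omega(j)}}{x_{\omega(i)}-x_{\omega(j)}},$$ and $0$ if $m<l$; this defines $P_{\lambda;a}\in\Gamma$ (with $P_{\varnothing;a}=1$, though by the stated convention $P_{(0,0);a}=0$). Rational functions of $u$ (resp. $v$) are expanded in powers of $u^{-1}$ (resp. $v^{-1}$). *)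

(* Defs.v *)
From HB Require Import structures.
From mathcomp Require Import all_boot all_order all_algebra all_fingroup.
From mathcomp Require Import zify.
From mathcomp Require Import boolp classical_sets functions cardinality fsbigop reals.
From mathcomp Require Import complex.
From mathcomp Require Import mpoly.

Set Implicit Arguments.
Unset Strict Implicit.
Unset Printing Implicit Defensive.

Import Order.TTheory GRing.Theory Num.Theory.
Local Open Scope classical_set_scope.
Local Open Scope ring_scope.

(** * Formal series in u^-1 and v^-1 with finitely many positive powers

    A series is given by its coefficients: the value at [(i, j)] is the
    coefficient of [u^i v^j], which must vanish as soon as [i] or [j] exceeds
    some bound. *)

Definition bounded_by (R : nzRingType) (N : int) (f : int * int -> R) : Prop :=
  forall p, (N < p.1) || (N < p.2) -> f p = 0.

Record lseries (R : nzRingType) := LSeries {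
  lcoef : int * int -> R;
  lcoefP : exists N, bounded_by N lcoef }.

HB.instance Definition _ (R : nzRingType) := gen_eqMixin (lseries R).
HB.instance Definition _ (R : nzRingType) := gen_choiceMixin (lseries R).

Lemma lseriesP (R : nzRingType) (f g : lseries R) :
  (forall p, lcoef f p = lcoef g p) -> f = g.
Proof.
case: f g => [f Pf] [g Pg] /= /funext fg; case: _ / fg in Pg *.
by congr LSeries; exact: Prop_irrelevance.
Qed.

Lemma bounded_by_le (R : nzRingType) (N M : int) (f : int * int -> R) :
  N <= M -> bounded_by N f -> bounded_by M f.
Proof. by move=> NM Nf p Mp; apply: Nf; lia. Qed.

Lemma lcoefP2 (R : nzRingType) (f g : lseries R) :
  exists N, bounded_by N (lcoef f) /\ bounded_by N (lcoef g).
Proof.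
case: (lcoefP f) (lcoefP g) => [N Nf] [M Mg]; exists ((`|N| + `|M|)%N : int).
by split; [refine (bounded_by_le _ Nf) | refine (bounded_by_le _ Mg)]; lia.
Qed.

Lemma lseries0P (R : nzRingType) :
  exists N, bounded_by N (fun=> 0 : R).
Proof. by exists 0. Qed.

Lemma lseries_monomP (R : nzRingType) (c : R) (p : int * int) :
  exists N, bounded_by N (fun q => if q == p then c else 0).
Proof.
exists ((`|p.1| + `|p.2|)%N : int) => q Hq; case: eqP => // qp.
by exfalso; case: p qp Hq => i j -> /=; lia.
Qed.

Lemma lseries_oppP (R : nzRingType) (f : lseries R) :
  exists N, bounded_by N (fun p => - lcoef f p).
Proof. by case: (lcoefP f) => N Nf; exists N => p /Nf ->; rewrite oppr0. Qed.

Lemma lseries_addP (R : nzRingType) (f g : lseries R) :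
  exists N, bounded_by N (fun p => lcoef f p + lcoef g p).
Proof.
case: (lcoefP2 f g) => N [Nf Ng]; exists N => p Np.
by rewrite Nf// Ng// addr0.
Qed.

Lemma fstB (p q : int * int) : (p - q).1 = p.1 - q.1. Proof. by []. Qed.
Lemma sndB (p q : int * int) : (p - q).2 = p.2 - q.2. Proof. by []. Qed.

(** The Cauchy product; the sum below has finite support for all bounded
    [f] and [g]. *)
Definition conv (R : nzRingType) (f g : int * int -> R) (p : int * int) : R :=
  \sum_(q \in [set: int * int]) f q * g (p - q).

Lemma lseries_mulP (R : nzRingType) (f g : lseries R) :
  exists N, bounded_by N (conv (lcoef f) (lcoef g)).
Proof.
case: (lcoefP2 f g) => N [Nf Ng]; exists (N + N) => -[p1 p2] /= Np.
apply: fsbig1 => -[q1 q2] _.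
have [Hq|Hq] := boolP ((N < q1) || (N < q2)); first by rewrite Nf// mul0r.
by rewrite Ng ?mulr0// fstB sndB /=; lia.
Qed.

Definition lmonom (R : nzRingType) (c : R) (p : int * int) : lseries R :=
  LSeries (lseries_monomP c p).
Definition lzero (R : nzRingType) : lseries R := LSeries (lseries0P R).
Definition lopp (R : nzRingType) (f : lseries R) : lseries R :=
  LSeries (lseries_oppP f).
Definition ladd (R : nzRingType) (f g : lseries R) : lseries R :=
  LSeries (lseries_addP f g).
Definition lmul (R : nzRingType) (f g : lseries R) : lseries R :=
  LSeries (lseries_mulP f g).

Fact laddA (R : nzRingType) : associative (@ladd R).
Proof. by move=> f g h; apply: lseriesP => p /=; rewrite addrA. Qed.
Fact laddC (R : nzRingType) : commutative (@ladd R).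
Proof. by move=> f g; apply: lseriesP => p /=; rewrite addrC. Qed.
Fact ladd0 (R : nzRingType) : left_id (lzero R) (@ladd R).
Proof. by move=> f; apply: lseriesP => p /=; rewrite add0r. Qed.
Fact laddN (R : nzRingType) : left_inverse (lzero R) (@lopp R) (@ladd R).
Proof. by move=> f; apply: lseriesP => p /=; rewrite addNr. Qed.

HB.instance Definition _ (R : nzRingType) :=
  GRing.isZmodule.Build (lseries R) (@laddA R) (@laddC R) (@ladd0 R) (@laddN R).

Definition irange (a b : int) : seq int :=
  [seq x <- [seq a + k%:Z | k <- iota 0 `|b - a|.+1] | x <= b].

Lemma mem_irange (a b x : int) : (x \in irange a b) = (a <= x <= b).
Proof.
rewrite mem_filter andbC; have [xb|] := boolP (x <= b); last by rewrite !andbF.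
rewrite !andbT; apply/mapP/idP => [[k _ ->]|ax]; first lia.
by exists `|x - a|%N; [rewrite mem_iota|]; lia.
Qed.

Lemma irange_uniq (a b : int) : uniq (irange a b).
Proof. apply: filter_uniq; rewrite map_inj_uniq; first exact: iota_uniq.
by move=> i j /addrI[]. Qed.

Definition ibox (lo hi : int * int) : seq (int * int) :=
  [seq (x, y) | x <- irange lo.1 hi.1, y <- irange lo.2 hi.2].

Lemma mem_ibox (lo hi q : int * int) :
  (q \in ibox lo hi) = (lo.1 <= q.1 <= hi.1) && (lo.2 <= q.2 <= hi.2).
Proof.
case: q => x y; rewrite -!mem_irange /=.
apply/allpairsP/andP => [[[i j] /= [Hi Hj [-> ->]]]|[Hx Hy]]//.
by exists (x, y).
Qed.

Lemma ibox_uniq (lo hi : int * int) : uniq (ibox lo hi).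
Proof. by apply: allpairs_uniq; rewrite ?irange_uniq// => -[? ?] [? ?]. Qed.

Lemma fsum_seq (R : nzRingType) (r : seq (int * int)) (F : int * int -> R) :
  uniq r -> (forall q, q \notin r -> F q = 0) ->
  \sum_(q \in [set: int * int]) F q = \sum_(q <- r) F q.
Proof.
move=> ur F0; rewrite (@bigfs _ _ _ _ r xpredT)//; last by move=> i _ /F0.
by apply: eq_fsbigl; apply/seteqP; split.
Qed.

Fact lmulC (R : comNzRingType) : commutative (@lmul R).
Proof.
move=> f g; apply: lseriesP => p /=; rewrite /conv.
have bij : bijective (fun q : int * int => p - q).
  by exists (fun q => p - q) => q; rewrite subKr.
rewrite (reindex_fsbigT _ _ bij); apply: eq_fsbigr => q _.
by rewrite subKr mulrC.
Qed.

Fact lmulA (R : comNzRingType) : associative (@lmul R).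
Proof.
move=> f g h; apply: lseriesP => -[p1 p2] /=; set p := (p1, p2).
case: (lcoefP2 f g) => N1 [N1f N1g]; case: (lcoefP h) => N2 N2h.
pose N := ((`|N1| + `|N2|)%N : int).
have Nf : bounded_by N (lcoef f) by refine (bounded_by_le _ N1f); rewrite /N; lia.
have Ng : bounded_by N (lcoef g) by refine (bounded_by_le _ N1g); rewrite /N; lia.
have Nh : bounded_by N (lcoef h) by refine (bounded_by_le _ N2h); rewrite /N; lia.
pose B1 := ibox (p1 - N - N, p2 - N - N) (N, N).
pose B2 := ibox (p1 - N, p2 - N) (N + N, N + N).
have E1 q : q \in B1 -> conv (lcoef g) (lcoef h) (p - q) =
    \sum_(s <- B2) lcoef g (s - q) * lcoef h (p - s).
  case: q => q1 q2; rewrite mem_ibox => /= Hq; rewrite /conv; set q := (q1, q2).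
  have bij : bijective (fun s : int * int => s - q).
    by exists (fun s => s + q) => s; rewrite ?subrK ?addrK.
  rewrite (reindex_fsbigT _ _ bij).
  under eq_fsbigr do rewrite opprB addrA subrK.
  apply: fsum_seq; first exact: ibox_uniq.
  move=> [s1 s2]; rewrite mem_ibox /= => Hs.
  have [Hh|Hh] := boolP ((N < p1 - s1) || (N < p2 - s2)).
    by rewrite Nh// mulr0.
  by rewrite Ng ?mul0r//; move: Hs Hh Hq; rewrite ?fstB ?sndB /=; lia.
have E2 s : s \in B2 -> conv (lcoef f) (lcoef g) s =
    \sum_(q <- B1) lcoef f q * lcoef g (s - q).
  case: s => s1 s2; rewrite mem_ibox => /= Hs; apply: fsum_seq; first exact: ibox_uniq.
  move=> [q1 q2]; rewrite mem_ibox /= => Hq.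
  have [Hf|Hf] := boolP ((N < q1) || (N < q2)); first by rewrite Nf// mul0r.
  by rewrite Ng ?mulr0//; move: Hs Hf Hq; rewrite ?fstB ?sndB /=; lia.
rewrite [LHS](@fsum_seq _ B1); first last.
- move=> [q1 q2]; rewrite mem_ibox /= => Hq.
  have [Hf|Hf] := boolP ((N < q1) || (N < q2)); first by rewrite Nf// mul0r.
  rewrite [conv _ _ _]fsbig1 ?mulr0// => -[r1 r2] _.
  have [Hg|Hg] := boolP ((N < r1) || (N < r2)); first by rewrite Ng// mul0r.
  by rewrite Nh ?mulr0//; move: Hf Hg Hq; rewrite ?fstB ?sndB /=; lia.
- exact: ibox_uniq.
rewrite [RHS](@fsum_seq _ B2); first last.
- move=> [s1 s2]; rewrite mem_ibox /= => Hs.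
  have [Hh|Hh] := boolP ((N < p1 - s1) || (N < p2 - s2)).
    by rewrite Nh// mulr0.
  rewrite [conv _ _ _]fsbig1 ?mul0r// => -[r1 r2] _.
  have [Hf|Hf] := boolP ((N < r1) || (N < r2)); first by rewrite Nf// mul0r.
  by rewrite Ng ?mulr0//; move: Hf Hh Hs; rewrite ?fstB ?sndB /=; lia.
- exact: ibox_uniq.
under eq_big_seq => q Hq do rewrite E1// mulr_sumr.
under [RHS]eq_big_seq => s Hs do rewrite E2// mulr_suml.
rewrite exchange_big; apply: eq_bigr => s _; apply: eq_bigr => q _.
by rewrite mulrA.
Qed.

Lemma lcoef_monomM (R : comNzRingType) (c : R) (p q : int * int) (f : lseries R) :
  lcoef (lmul (lmonom c p) f) q = c * lcoef f (q - p).
Proof.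
rewrite /= /conv (@fsum_seq _ [:: p])//; first by rewrite big_seq1 eqxx.
by move=> r; rewrite inE => /negPf ->; rewrite mul0r.
Qed.

Fact lmul1 (R : comNzRingType) : left_id (lmonom 1 0) (@lmul R).
Proof. by move=> f; apply: lseriesP => p; rewrite lcoef_monomM mul1r subr0. Qed.

Fact lmulDl (R : comNzRingType) : left_distributive (@lmul R) (@ladd R).
Proof.
move=> f g h; apply: lseriesP => -[p1 p2] /=; rewrite /conv; set p := (p1, p2).
case: (lcoefP2 f g) => N1 [N1f N1g]; case: (lcoefP h) => N2 N2h.
pose B := ibox (p1 - N2, p2 - N2) (N1, N1).
have out q : q \notin B -> lcoef f q * lcoef h (p - q) = 0 /\
                           lcoef g q * lcoef h (p - q) = 0.
  case: q => q1 q2; rewrite mem_ibox /= => Hq.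
  have [Hf|Hf] := boolP ((N1 < q1) || (N1 < q2)).
    by rewrite N1f// N1g// mul0r.
  by rewrite N2h ?mulr0//; move: Hq Hf; rewrite ?fstB ?sndB /=; lia.
rewrite !(@fsum_seq _ B) ?ibox_uniq//.
- by rewrite -big_split; apply: eq_bigr => q _; rewrite mulrDl.
- by move=> q /out[].
- by move=> q /out[].
- by move=> q /out[Ef Eg]; rewrite mulrDl Ef Eg addr0.
Qed.

Fact lone_neq0 (R : comNzRingType) : lmonom 1 0 != lzero R.
Proof.
apply/eqP => /(congr1 (fun f => lcoef f 0)) /= E.
by have := oner_neq0 R; rewrite -E eqxx.
Qed.

HB.instance Definition _ (R : comNzRingType) :=
  GRing.Zmodule_isComNzRing.Build (lseries R)
    (@lmulA R) (@lmulC R) (@lmul1 R) (@lmulDl R) (@lone_neq0 R).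

Definition lunit (R : comNzRingType) : pred (lseries R) :=
  fun f => `[< exists g, g * f = 1 >].
Definition linv (R : comNzRingType) (f : lseries R) : lseries R :=
  if pselect (exists g, g * f = 1) is left Hf then projT1 (cid Hf) else f.

Fact lmulV (R : comNzRingType) : {in @lunit R, left_inverse 1 (@linv R) *%R}.
Proof.
move=> f /asboolP Hf; rewrite /linv; case: pselect => // H.
by case: (cid H).
Qed.
Fact lunitP (R : comNzRingType) (f g : lseries R) : g * f = 1 -> lunit f.
Proof. by move=> gf; apply/asboolP; exists g. Qed.
Fact linv_out (R : comNzRingType) : {in [predC @lunit R], @linv R =1 id}.
Proof. by move=> f /asboolP Hf; rewrite /linv; case: pselect. Qed.

HB.instance Definition _ (R : comNzRingType) :=
  GRing.ComNzRing_hasMulInverse.Build (lseries R)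
    (@lmulV R) (@lunitP R) (@linv_out R).

Definition lconst (R : nzRingType) (c : R) : lseries R := lmonom c 0.
Definition lu (R : nzRingType) : lseries R := lmonom 1 (1, 0).
Definition lv (R : nzRingType) : lseries R := lmonom 1 (0, 1).

(** [f^-1] is the inverse in the ring of series whenever there is one. For
    [u - c] it is the geometric series in [u^-1]: *)
Lemma lgeom_subproof (R : comNzRingType) (c : R) :
  exists N, bounded_by N
    (fun p => if (p.1 < 0) && (p.2 == 0) then c ^+ `|p.1 + 1| else 0).
Proof. by exists 0 => -[i j] /= ij; rewrite ifF//; lia. Qed.

Definition lgeom (R : comNzRingType) (c : R) : lseries R :=
  LSeries (lgeom_subproof c).

Lemma lgeomM (R : comNzRingType) (c : R) : lgeom c * (lu R - lconst c) = 1.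
Proof.
apply: lseriesP => -[i j].
rewrite mulrC mulrBl.
have -> : lcoef (lu R * lgeom c - lconst c * lgeom c) (i, j) =
    1 * lcoef (lgeom c) ((i, j) - (1, 0)) - c * lcoef (lgeom c) ((i, j) - 0).
  by rewrite -!lcoef_monomM.
rewrite mul1r subr0 /= subr0.
rewrite -[RHS]/(if (i, j) == (0, 0) then 1 else 0) xpair_eqE.
have [_|_] := eqVneq j 0; last by rewrite !andbF mulr0 subr0.
rewrite !andbT.
case: (ltrgtP i 0) => i0.
- rewrite ifT; last lia.
  have -> : absz (i - 1 + 1) = (absz (i + 1)).+1 by lia.
  by rewrite exprS subrr.
- by rewrite ifF ?mulr0 ?subr0//; lia.
- by rewrite i0 mulr0 subr0.
Qed.

Lemma invr_lu_sub (R : comNzRingType) (c : R) : (lu R - lconst c)^-1 = lgeom c.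
Proof.
have U : lu R - lconst c \is a GRing.unit := lunitP (lgeomM c).
by apply: (mulIr U); rewrite mulVr// lgeomM.
Qed.

(** Coefficientwise sum of a family of series: at every monomial only finitely
    many members contribute. *)
Definition is_formal_sum (R : nzRingType) (F : nat -> nat -> lseries R)
    (S : lseries R) : Prop :=
  forall p : int * int,
    finite_set [set kl : nat * nat | lcoef (F kl.1 kl.2) p != 0] /\
    lcoef S p = \sum_(kl \in [set: nat * nat]) lcoef (F kl.1 kl.2) p.

(** * Multiparameter Schur P-functions *)

(** [(x | b)^k]; the parameters are numbered from 1 and [b 0] is not used. *)
Definition fpow (A : nzRingType) (b : nat -> A) (x : A) (k : nat) : A :=
  \prod_(1 <= m < k.+1) (x - b m).

(** Rational functions in [x_0, ..., x_{n-1}] over the complex numbers. *)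
Notation ratfun R n := {fraction {mpoly (complex R)[n]}}.

Definition rvar (R : realType) (n : nat) (i : 'I_n) : ratfun R n :=
  tofrac ('X_i : {mpoly (complex R)[n]}).
Definition rcst (R : realType) (n : nat) (c : complex R) : ratfun R n :=
  tofrac (c%:MP : {mpoly (complex R)[n]}).

(** [P_{lam; a}(x_0, ..., x_{n-1})] for a strict partition [lam], listed
    without zero parts. *)
Definition schurP (R : realType) (a : nat -> complex R) (lam : seq nat)
    (n : nat) : ratfun R n :=
  if (n < size lam)%N then 0 else
  ((n - size lam)`!%:R)^-1 *
  \sum_(w : 'S_n)
    ((\prod_(i < n | (i < size lam)%N)
        fpow (fun m => rcst n (a m)) (rvar R (w i)) (nth 0%N lam i)) *
     \prod_(i < n | (i < size lam)%N) \prod_(j < n | (i < j)%N)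
        ((rvar R (w i) + rvar R (w j)) / (rvar R (w i) - rvar R (w j)))).

(** [P_{(k,l); a}], extended skew-symmetrically to all [k, l]; the convention
    [P_{(k,k)} = - P_{(k,k)}] gives [0] on the diagonal, including
    [P_{(0,0)} = 0]. *)
Definition schurP2 (R : realType) (a : nat -> complex R) (k l : nat)
    (n : nat) : ratfun R n :=
  let part i j := if j == 0%N then [:: i] else [:: i; j] in
  if (l < k)%N then schurP a (part k l) n
  else if (k < l)%N then - schurP a (part l k) n
  else 0.

(** [\prod_j (z + x_j) / (z - x_j)], for [z] one of [u], [v]. *)
Definition genQ (R : realType) (n : nat) (z : lseries (ratfun R n)) :
    lseries (ratfun R n) :=
  \prod_(j < n) ((z + lconst (rvar R j)) / (z - lconst (rvar R j))).

(* Main.v *)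
(** Put [A_i = \prod_(m != i) (x_i + x_m) / (x_i - x_m)] and
    [c_ij = - A_i A_j (x_i - x_j) / (x_i + x_j)]. Grouping the permutations by
    the images of the first one or two indices gives
    [P_(k) = \sum_i A_i (x_i | a)^k] and
    [P_(k,l) = \sum_(i,j) c_ij (x_i | a)^k (x_j | a)^l] for [k, l > 0]; the
    skew-symmetric extension comes for free since [c_ij] is skew-symmetric.
    As [a_1 = 0], telescoping gives
    [\sum_(k > 0) (x | a)^k / (u | a)^(k+1) = 1 / (u - x) - 1 / u], so the sum
    of the family is an explicit rational function of [u] and [v]. The identity
    then follows from the partial fraction expansion
    [\prod_j (z + x_j) / (z - x_j) = 1 + \sum_i 2 x_i A_i / (z - x_i)], used at
    [z = u], [z = v], and at [z = - x_i], where the left-hand side vanishes. *)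

From HB Require Import structures.
Require Import Defs.
From mathcomp Require Import boolp classical_sets cardinality fsbigop.
From mathcomp Require Import all_boot all_order all_algebra all_fingroup.
From mathcomp Require Import reals complex mpoly ring zify.

Set Implicit Arguments.
Unset Strict Implicit.
Unset Printing Implicit Defensive.

Import Order.TTheory GRing.Theory Num.Theory.
Local Open Scope ring_scope.

(** * Sums over permutations that depend on one or two values *)

Section PermutationSums.
Variable T : finType.

(** Right multiplication by [s^-1] turns the permutations agreeing with [s] on [A] into those that
    fix [A] pointwise, that is, the permutations of the complement of [A]. *)
Lemma card_perm_agree (A : {set T}) (s : {perm T}) :
  #|[set w : {perm T} | [forall x in A, w x == s x]]| = (#|T| - #|A|)`!.
Proof.
have -> : (#|T| - #|A|)%N = #|~: A| by rewrite -(cardsC A) addKn.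
rewrite -card_perm -(card_imset _ (mulIg s^-1)%g).
apply: eq_card => w; rewrite [RHS]inE; apply/imsetP/subsetP => [[w1 + ->] x|wA].
  rewrite inE => /'forall_in_eqP E; rewrite !inE; apply: contraNN => xA.
  by rewrite permM E // permK.
exists (w * s)%g; last by rewrite mulgK.
rewrite inE; apply/'forall_in_eqP => x xA; rewrite permM.
case: (eqVneq (w x) x) => [->//|wx].
by have := wA x; rewrite !inE xA => /(_ wx).
Qed.

Variable V : zmodType.

Lemma sum_perm_at (t : T) (f : T -> V) :
  \sum_(w : {perm T}) f (w t) = (\sum_i f i) *+ (#|T| - 1)`!.
Proof.
rewrite (partition_big (fun w : {perm T} => w t) xpredT)//= -sumrMnl.
apply: eq_bigr => i _.
rewrite (eq_bigr (fun=> f i)) => [|w /eqP -> //].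
rewrite sumr_const -(cards1 t) -(card_perm_agree _ (tperm t i)); congr (_ *+ _).
apply: eq_card => w; rewrite inE; apply/idP/'forall_in_eqP => [/eqP <- s|E].
  by rewrite inE => /eqP ->; rewrite tpermL.
apply/eqP; rewrite E; last by rewrite inE.
exact: tpermL.
Qed.

Lemma sum_perm_at2 (t t' : T) (f : T -> T -> V) : t != t' ->
  \sum_(w : {perm T}) f (w t) (w t') = (\sum_i \sum_(j | j != i) f i j) *+ (#|T| - 2)`!.
Proof.
move=> tt'; rewrite pair_big_dep/=.
rewrite (partition_big (fun w : {perm T} => (w t, w t')) (fun ij => ij.2 != ij.1)) => [|w _]; last first.
  by rewrite (inj_eq perm_inj) eq_sym.
rewrite -sumrMnl; apply: eq_bigr => -[i j] /= ij.
rewrite (eq_bigr (fun=> f i j)) => [|w /eqP[-> ->] //].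
(* First [t] goes to [i]; then the image of [t'] is moved to [j], which leaves [i] in place since
   [i] is neither that image nor [j]. *)
pose s := (tperm t i * tperm (tperm t i t') j)%g.
have st : s t = i.
  rewrite permM tpermL tpermD//.
  by rewrite -[X in _ != X](tpermL t i) (inj_eq perm_inj) eq_sym.
have st' : s t' = j by rewrite permM tpermL.
have c2 : #|[set t; t']| = 2%N by rewrite cards2 tt'.
rewrite sumr_const -c2 -(card_perm_agree _ s); congr (_ *+ _).
apply: eq_card => w; rewrite inE; apply/idP/'forall_in_eqP => [/andP[/eqP/= wt /eqP/= wt'] r|E].
  by rewrite !inE => /orP[]/eqP ->; rewrite ?st ?st'.
by apply/andP; split; apply/eqP; rewrite /= E ?st ?st' // !inE eqxx ?orbT.
Qed.

Lemma prod_perm_neq (A : comNzRingType) (w : {perm T}) (t : T) (h : T -> A) :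
  \prod_(j | j != t) h (w j) = \prod_(m | m != w t) h m.
Proof.
rewrite [RHS](reindex_inj (@perm_inj _ w)); apply: eq_bigl => j.
by rewrite (inj_eq perm_inj).
Qed.

End PermutationSums.

(** * Partial fractions of the product of [(z + x_j) / (z - x_j)] *)

Section PartialFractions.
Variables (F : fieldType) (n : nat) (x : 'I_n -> F).
Hypothesis injx : injective x.

(** The [A_i] of the overview: [2 x_i A_i] is the residue of the product at [z = x_i]. *)
Definition ratioP (i : 'I_n) : F := \prod_(m < n | m != i) ((x i + x m) / (x i - x m)).

(** The difference [D] of the two sides has degree less than [n], since both full products are monic
    of degree [n], and it vanishes at the [n] distinct points [x i]. *)
Lemma partial_fractions_poly :
  \prod_(j < n) ('X + (x j)%:P) = \prod_(j < n) ('X - (x j)%:P) +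
    \sum_(i < n) (2%:R * x i * ratioP i) *: \prod_(j < n | j != i) ('X - (x j)%:P).
Proof.
apply/eqP; rewrite -subr_eq0 opprD addrA; set D := (X in X == 0).
have szI : size (index_enum 'I_n) = n by rewrite [index_enum _]unlock -enumT size_enum_ord.
have sz (y : 'I_n -> F) : size (\prod_(j < n) ('X - (y j)%:P)) = n.+1.
  by rewrite size_prod_XsubC szI.
have NX (y : F) : 'X + y%:P = 'X - (- y)%:P by rewrite polyCN opprK.
have sD : (size D <= n)%N.
  rewrite /D; apply: leq_trans (size_polyD _ _) _; rewrite size_polyN geq_max; apply/andP; split.
    apply/leq_sizeP => j; rewrite leq_eqVlt => /orP[/eqP <-|nj].
      under eq_bigr do rewrite NX.
      rewrite coefB.
      have mon (y : 'I_n -> F) : (\prod_(j < n) ('X - (y j)%:P))`_n = 1.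
        have /monicP := monic_prod_XsubC (index_enum 'I_n) xpredT y.
        by rewrite lead_coefE sz.
      by rewrite !mon subrr.
    under eq_bigr do rewrite NX.
    by rewrite coefB !nth_default ?subrr// sz.
  apply: (big_ind (fun p : {poly F} => (size p <= n)%N)) => [|p q pn qn|i _].
  - by rewrite size_poly0.
  - by apply: leq_trans (size_polyD _ _) _; rewrite geq_max pn.
  apply: leq_trans (size_scale_leq _ _) _.
  rewrite -big_filter size_prod_XsubC size_filter.
  rewrite -[X in (_ <= X)%N]szI -(count_predC (fun j => j != i)) -addn1 leq_add2l.
  by rewrite -has_count; apply/hasP; exists i; rewrite ?mem_index_enum//= eqxx.
apply: contraTT sD => nzD; rewrite -ltnNge.
have := max_poly_roots nzD (_ : all (root D) [seq x i | i <- enum 'I_n]).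
rewrite size_map size_enum_ord; apply; last by rewrite map_inj_uniq ?enum_uniq.
apply/allP => _ /mapP[i _ ->]; rewrite /root /D.
have E0 (k : 'I_n) (Q : pred 'I_n) : Q k -> (\prod_(j < n | Q j) ('X - (x j)%:P)).[x k] = 0.
  by move=> Qk; rewrite horner_prod (bigD1 k)//= hornerXsubC subrr mul0r.
rewrite !hornerD !hornerN E0// subr0 horner_sum subr_eq0; apply/eqP.
rewrite [RHS](bigD1 i)//=.
rewrite [X in _ = _ + X]big1 ?addr0 => [|j ji]; last first.
  by rewrite hornerZ E0 ?mulr0// eq_sym.
rewrite hornerZ !horner_prod (bigD1 i)//= hornerD hornerX hornerC mulr_natl mulr2n.
rewrite /ratioP -mulrA -big_split/=; congr (_ * _).
apply: eq_bigr => j ji.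
by rewrite hornerD hornerXsubC hornerX hornerC divfK// subr_eq0 (inj_eq injx) eq_sym.
Qed.

(** The polynomial identity is evaluated at [z] and divided by a unit, so [B] can be the ring of
    series (at [u] and [v]) as well as [F] itself (at [- x_i]). *)
Lemma partial_fractions (B : comUnitRingType) (phi : {rmorphism F -> B}) (z : B) :
  (forall i, z - phi (x i) \is a GRing.unit) ->
  \prod_(j < n) ((z + phi (x j)) / (z - phi (x j))) =
    1 + \sum_(i < n) phi (2%:R * x i * ratioP i) / (z - phi (x i)).
Proof.
move=> Uz; pose ev p := (map_poly phi p).[z].
have := congr1 ev partial_fractions_poly; rewrite /ev.
rewrite rmorphD/= raddf_sum/= !rmorph_prod/= hornerD horner_sum !horner_prod.
under eq_bigr do rewrite rmorphD/= map_polyX map_polyC/= hornerD hornerX hornerC.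
under [X in _ = X + _]eq_bigr do rewrite rmorphB/= map_polyX map_polyC/= hornerD hornerN hornerX hornerC.
move=> E.
have UP : \prod_(j < n) (z - phi (x j)) \is a GRing.unit by apply: rpred_prod => i _.
rewrite big_split/= E prodrV// mulrDl divrr//; congr (_ + _).
rewrite mulr_suml; apply: eq_bigr => i _.
rewrite map_polyZ hornerZ rmorph_prod/= horner_prod.
have -> : \prod_(j < n) (z - phi (x j)) =
    (z - phi (x i)) * \prod_(j < n | j != i) (z - phi (x j)) by rewrite (bigD1 i).
under eq_bigr do rewrite rmorphB/= map_polyX map_polyC/= hornerD hornerN hornerX hornerC.
have Ui : \prod_(j < n | j != i) (z - phi (x j)) \is a GRing.unit.
  by apply: rpred_prod => j _.
by rewrite invrM// -[LHS]mulrA mulVKr.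
Qed.

End PartialFractions.

(** * Constants as a subring of the series *)

Section SeriesConstants.
Variable R : comNzRingType.

Fact lconst_is_zmod_morphism : zmod_morphism (@lconst R).
Proof.
move=> c d; apply: lseriesP => p /=.
by case: eqP => _; rewrite ?subrr.
Qed.

Fact lconst_is_monoid_morphism : monoid_morphism (@lconst R).
Proof.
split=> // c d; apply: lseriesP => p.
by rewrite lcoef_monomM subr0 /=; case: eqP => _; rewrite ?mulr0.
Qed.

HB.instance Definition _ :=
  GRing.isZmodMorphism.Build R (lseries R) (@lconst R) lconst_is_zmod_morphism.
HB.instance Definition _ :=
  GRing.isMonoidMorphism.Build R (lseries R) (@lconst R) lconst_is_monoid_morphism.

End SeriesConstants.

(** * The exchange of [u] and [v] *)

Section Swap.
Variable R : comNzRingType.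

Definition swap_pair (p : int * int) : int * int := (p.2, p.1).

Fact lswap_subproof (f : lseries R) : exists N, bounded_by N (lcoef f \o swap_pair).
Proof. by case: (lcoefP f) => N fN; exists N => p; rewrite orbC => /(fN (swap_pair p)). Qed.

(** As a ring morphism this carries the facts about [(u - c)^-1] over to [v], without a second
    geometric series. *)
Definition lswap (f : lseries R) : lseries R := LSeries (lswap_subproof f).

Fact lswap_is_zmod_morphism : zmod_morphism lswap.
Proof. by move=> f g; apply: lseriesP => p. Qed.

Fact lswap_is_monoid_morphism : monoid_morphism lswap.
Proof.
split=> [|f g]; apply: lseriesP => -[i j].
  by rewrite /= /swap_pair/= -!pair_eqE/= andbC.
rewrite /= /conv /=.
have bij : bijective swap_pair by exists swap_pair => -[].
rewrite (reindex_fsbigT _ _ bij); apply: eq_fsbigr => -[k l] _.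
by [].
Qed.

HB.instance Definition _ :=
  GRing.isZmodMorphism.Build (lseries R) (lseries R) lswap lswap_is_zmod_morphism.
HB.instance Definition _ :=
  GRing.isMonoidMorphism.Build (lseries R) (lseries R) lswap lswap_is_monoid_morphism.

Lemma lswap_lu : lswap (lu R) = lv R.
Proof.
by apply: lseriesP => -[i j]; rewrite /= /swap_pair/= -!pair_eqE/= andbC.
Qed.

Lemma lswap_lconst c : lswap (lconst c) = lconst c.
Proof.
by apply: lseriesP => -[i j]; rewrite /= /swap_pair/= -!pair_eqE/= andbC.
Qed.

End Swap.

(** * Degree bounds in one variable *)

Section Degree.
Variable R : comNzRingType.

(** With [pr] equal to [fst] or [snd], this bounds the degree in [u] or in [v]. *)
Definition deg_le (pr : {additive int * int -> int}) (N : int) (f : lseries R) :=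
  forall p, N < pr p -> lcoef f p = 0.

Variable pr : {additive int * int -> int}.

Lemma deg_leW N M f : N <= M -> deg_le pr N f -> deg_le pr M f.
Proof. by move=> NM fN p Mp; apply: fN; lia. Qed.

Lemma deg_leD N f g : deg_le pr N f -> deg_le pr N g -> deg_le pr N (f + g).
Proof. by move=> fN gN p Np; rewrite /= fN// gN// addr0. Qed.

Lemma deg_leN N f : deg_le pr N f -> deg_le pr N (- f).
Proof. by move=> fN p Np; rewrite /= fN// oppr0. Qed.

Lemma deg_le_sum N (I : Type) (r : seq I) (P : pred I) (f : I -> lseries R) :
  (forall i, P i -> deg_le pr N (f i)) -> deg_le pr N (\sum_(i <- r | P i) f i).
Proof. by move=> fN; apply: big_ind => //; exact: deg_leD. Qed.

Lemma deg_leM N M f g : deg_le pr N f -> deg_le pr M g -> deg_le pr (N + M) (f * g).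
Proof.
move=> fN gM p NMp /=; apply: fsbig1 => q _.
have [Nq|qN] := ltP N (pr q); first by rewrite fN// mul0r.
rewrite gM ?mulr0// raddfB ltrBrDr; apply: le_lt_trans NMp.
by rewrite addrC lerD2r.
Qed.

Lemma deg_le_lconst c : deg_le pr 0 (lconst c).
Proof. by move=> p p0 /=; case: eqP => // E; rewrite E raddf0 in p0. Qed.

Lemma deg_le_lconstM N c f : deg_le pr N f -> deg_le pr N (lconst c * f).
Proof. by move=> fN; rewrite -[N]add0r; apply: deg_leM fN; exact: deg_le_lconst. Qed.

End Degree.

(** * Factorial powers and the telescoping sum *)

Section FactorialPowers.

Lemma fpow0 (A : nzRingType) (b : nat -> A) x : fpow b x 0 = 1.
Proof. by rewrite /fpow big_geq. Qed.

Lemma fpowS (A : nzRingType) (b : nat -> A) x k :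
  fpow b x k.+1 = fpow b x k * (x - b k.+1).
Proof. by rewrite /fpow big_nat_recr. Qed.

Lemma rmorph_fpow (A B : nzRingType) (phi : {rmorphism A -> B}) (b : nat -> A) x k :
  phi (fpow b x k) = fpow (phi \o b) (phi x) k.
Proof. by rewrite /fpow rmorph_prod; apply: eq_bigr => m _; rewrite rmorphB. Qed.

Lemma fpow_unit (A : comUnitRingType) (b : nat -> A) z k :
  (forall m, z - b m \is a GRing.unit) -> fpow b z k \is a GRing.unit.
Proof. by move=> Uz; apply: rpred_prod => m _. Qed.

(** The term [k] is the difference of the values at [k] and [k + 1] of
    [fpow b x k / fpow b z k / (z - x)], because [z - x = (z - b k.+1) - (x - b k.+1)]. *)
Lemma sum_fpow_div (A : comUnitRingType) (b : nat -> A) (x z : A) K :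
  z - x \is a GRing.unit -> (forall m, z - b m \is a GRing.unit) ->
  \sum_(0 <= k < K) fpow b x k / fpow b z k.+1 =
    (z - x)^-1 - fpow b x K / fpow b z K / (z - x).
Proof.
move=> Ux Ub; elim: K => [|K IH]; first by rewrite big_geq// !fpow0 divr1 mul1r subrr.
rewrite big_nat_recr//= IH !fpowS invrM ?fpow_unit//.
set p := fpow b x K; set q := (fpow b z K)^-1; set r := (z - b K.+1)^-1.
set s := (z - x)^-1.
(* The inverses [r] and [s] are opaque to [ring]; inserting [s * (z - x) = 1] and
   [r * (z - b K.+1) = 1] leaves a polynomial identity. *)
have -> : p * (r * q) = p * q * r * (s * (z - x)) by rewrite mulVr//; ring.
have -> : p * q * s = p * q * s * (r * (z - b K.+1)) by rewrite mulVr// mulr1.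
by ring.
Qed.

End FactorialPowers.

(** * The closing identity in a commutative ring, with [D i j] inverse to [X i + X j] *)

Section TwoVariableIdentity.
Variables (B : comUnitRingType) (n : nat) (X A : 'I_n -> B) (D : 'I_n -> 'I_n -> B).
Variables (u v : B).
Hypothesis (Uu : u \is a GRing.unit) (Uv : v \is a GRing.unit).
Hypothesis (UuX : forall i, u - X i \is a GRing.unit).
Hypothesis (UvX : forall i, v - X i \is a GRing.unit).
Hypothesis DP : forall i j, D i j * (X i + X j) = 1.
Hypothesis DC : forall i j, D i j = D j i.
Hypothesis sumD : forall i, \sum_j 2%:R * X j * A j * D i j = 1.

(* The cross terms are separated by
   [(u + v)(x - y) = (u - v)(x + y) + 2 (x (v - y) - y (u - x))]. *)
Lemma two_variable_identity_term i j :
  4%:R * u * v * (u + v) *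
    (- (A i * A j * (X i - X j) * D i j) *
      (((u - X i)^-1 - u^-1) * ((v - X j)^-1 - v^-1))) =
  - (u - v) * ((2%:R * X i * A i / (u - X i)) * (2%:R * X j * A j / (v - X j)))
  - 2%:R * ((u / (u - X i) - 1) * (2%:R * X i * A i) * (2%:R * X j * A j * D i j)
          - (v / (v - X j) - 1) * (2%:R * X j * A j) * (2%:R * X i * A i * D j i)).
Proof.
rewrite (DC j i); set W := (u - X i)^-1; set W' := (v - X j)^-1.
have HW : W * (u - X i) = 1 by rewrite mulVr.
have HW' : W' * (v - X j) = 1 by rewrite mulVr.
have E : u * W - 1 = X i * W by rewrite -HW; ring.
have E' : v * W' - 1 = X j * W' by rewrite -HW'; ring.
have G : u * (W - u^-1) = X i * W by rewrite mulrBr divrr.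
have G' : v * (W' - v^-1) = X j * W' by rewrite mulrBr divrr.
rewrite E E'.
transitivity (- 4%:R * A i * A j * (u + v) * (X i - X j) * D i j *
   ((u * (W - u^-1)) * (v * (W' - v^-1)))); first by ring.
rewrite G G'.
(* This is the separation of cross terms multiplied by [D i j * W * W']; the bracketed products all
   equal 1. *)
transitivity (- 4%:R * A i * A j * X i * X j *
  ((u - v) * W * W' * (D i j * (X i + X j)) +
   2%:R * X i * D i j * W * (W' * (v - X j)) -
   2%:R * X j * D i j * W' * (W * (u - X i)))); first by ring.
by rewrite DP HW HW'; ring.
Qed.

(** Let [q], [q'] be [Qu - 1], [Qv - 1]. The single sum gives [2 (u + v) (q - q')]. In the double
    sum [sumD] removes one index from each cross term, leaving [- (u - v) q q' - 2 (u q - v q')];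
    the constant [s] cancels. *)
Lemma two_variable_identity Qu Qv :
  Qu = 1 + \sum_i 2%:R * X i * A i / (u - X i) ->
  Qv = 1 + \sum_i 2%:R * X i * A i / (v - X i) ->
  4%:R * u * v * (u + v) *
    (\sum_i \sum_j - (A i * A j * (X i - X j) * D i j) *
        (((u - X i)^-1 - u^-1) * ((v - X j)^-1 - v^-1)) +
     \sum_i A i * (((u - X i)^-1 - u^-1) / v - ((v - X i)^-1 - v^-1) / u)) =
  u * (Qu + 1) * (- Qv + 1) - v * (- Qu + 1) * (Qv + 1).
Proof.
move=> -> ->; pose q := \sum_i 2%:R * X i * A i / (u - X i).
pose q' := \sum_i 2%:R * X i * A i / (v - X i).
pose s := \sum_i 2%:R * X i * A i.
rewrite mulrDr; have -> : 4%:R * u * v * (u + v) *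
    \sum_i A i * (((u - X i)^-1 - u^-1) / v - ((v - X i)^-1 - v^-1) / u) =
    2%:R * (u + v) * (q - q').
  rewrite -sumrB !mulr_sumr; apply: eq_bigr => i _.
  set W := (u - X i)^-1; set W' := (v - X i)^-1.
  have G : u * (W - u^-1) = X i * W.
    by rewrite mulrBr divrr// -(mulVr (UuX i)) -/W; ring.
  have G' : v * (W' - v^-1) = X i * W'.
    by rewrite mulrBr divrr// -(mulVr (UvX i)) -/W'; ring.
  transitivity (4%:R * (u + v) * A i *
    (u * (W - u^-1) * (v / v) - v * (W' - v^-1) * (u / u))); first by ring.
  by rewrite !divrr// G G'; ring.
have -> : 4%:R * u * v * (u + v) *
    (\sum_i \sum_j - (A i * A j * (X i - X j) * D i j) *
        (((u - X i)^-1 - u^-1) * ((v - X j)^-1 - v^-1))) =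
    - (u - v) * (q * q') - 2%:R * ((u * q - s) - (v * q' - s)).
  rewrite mulr_sumr; under eq_bigr do rewrite mulr_sumr.
  under eq_bigr do under eq_bigr do rewrite two_variable_identity_term.
  under eq_bigr do rewrite sumrB -!mulr_sumr sumrB.
  rewrite sumrB -!mulr_sumr -mulr_suml -/q -/q' sumrB.
  congr (_ - 2%:R * (_ - _)).
  - under eq_bigr do rewrite -mulr_sumr sumD mulr1.
    rewrite mulr_sumr -sumrB; apply: eq_bigr => i _; ring.
  (* Here the inner sum must run over [i]; the form [D j i] of the term is the one that [sumD]
     expects. *)
  - rewrite exchange_big /=; under eq_bigr do rewrite -mulr_sumr sumD mulr1.
    rewrite mulr_sumr -sumrB; apply: eq_bigr => i _; ring.
by rewrite -/q -/q' /=; ring.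
Qed.

End TwoVariableIdentity.

(** * Expansions in one variable and their remainders *)

Section LinearVariables.
Variable R : comNzRingType.

(** The common properties of [u] and [v] from which the estimates follow: [pr] is the degree in [z]
    and [pr'] the degree in the other variable. *)
Definition linear_var (pr pr' : {additive int * int -> int}) (z : lseries R) :=
  forall c, [/\ z - lconst c \is a GRing.unit,
    deg_le pr (-1) (z - lconst c)^-1 & deg_le pr' 0 (z - lconst c)^-1].

Lemma linear_var_lu : linear_var fst snd (lu R).
Proof.
move=> c; rewrite invr_lu_sub; split; first exact: lunitP (lgeomM c).
  by move=> p /= p1; rewrite ifF//; lia.
by move=> p /= p2; rewrite ifF//; lia.
Qed.

Lemma linear_var_lv : linear_var snd fst (lv R).
Proof.
move=> c; have [U d1 d2] := linear_var_lu c.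
have -> : lv R - lconst c = lswap (lu R - lconst c).
  by rewrite rmorphB/= lswap_lu lswap_lconst.
rewrite -rmorphV//; split; first exact: rmorph_unit.
  by move=> p; exact: d1 (swap_pair p).
by move=> p; exact: d2 (swap_pair p).
Qed.

Variables (pr pr' : {additive int * int -> int}) (z : lseries R).
Hypothesis zP : linear_var pr pr' z.

Lemma linear_var_unit : z \is a GRing.unit.
Proof. by have [] := zP 0; rewrite rmorph0 subr0. Qed.

Lemma deg_le_inv_fpow (b : nat -> R) k :
  deg_le pr (- k%:Z) (fpow (@lconst R \o b) z k)^-1 /\
  deg_le pr' 0 (fpow (@lconst R \o b) z k)^-1.
Proof.
elim: k => [|k [IH IH']].
  by rewrite fpow0 invr1 -(rmorph1 (@lconst R)); split; exact: deg_le_lconst.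
have [U d d'] := zP (b k.+1).
rewrite fpowS invrM//; last by apply: fpow_unit => m; case: (zP (b m)).
split; last exact: (deg_leM d' IH').
by rewrite (_ : - k.+1%:Z = - 1 + - k%:Z); [exact: deg_leM | lia].
Qed.

Variables (b : nat -> R) (x : R).
Hypothesis b1 : b 1%N = 0.

(* The value [0] at [k = 0] makes the formulas for one and two rows agree. *)
Definition fpow_pos (k : nat) : R := if k == 0%N then 0 else fpow b x k.

Definition fpow_series (K : nat) : lseries R :=
  \sum_(0 <= k < K) lconst (fpow_pos k) / fpow (@lconst R \o b) z k.+1.

(** [fpow_pos] drops the term [k = 0] of the telescoping sum, which is [(z - b 1)^-1 = z^-1] because
    [b 1 = 0]. *)
Lemma fpow_series_remainder K : (0 < K)%N ->
  (z - lconst x)^-1 - z^-1 - fpow_series K =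
    lconst (fpow b x K) / fpow (@lconst R \o b) z K / (z - lconst x).
Proof.
move=> K0; have Ub m : z - lconst (b m) \is a GRing.unit by case: (zP (b m)).
have [Ux _ _] := zP x.
have := sum_fpow_div K Ux Ub; rewrite -(rmorph_fpow (@lconst R)) => E.
have -> : fpow_series K = \sum_(0 <= k < K) fpow (@lconst R \o b) (lconst x) k /
    fpow (@lconst R \o b) z k.+1 - z^-1.
  rewrite /fpow_series !(big_ltn K0) /= rmorph0 mul0r add0r fpow0 fpowS fpow0.
  rewrite mul1r /= b1 rmorph0 subr0 mul1r [RHS]addrC addKr.
  by apply: eq_big_nat => -[|k]// _; rewrite /fpow_pos/= (rmorph_fpow (@lconst R)).
by rewrite E; ring.
Qed.

Lemma deg_le_fpow_series_remainder K : (0 < K)%N ->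
  deg_le pr (- K%:Z) ((z - lconst x)^-1 - z^-1 - fpow_series K).
Proof.
move=> K0; rewrite fpow_series_remainder//.
have [_ d _] := zP x; have [d1 _] := deg_le_inv_fpow b K.
apply: deg_leW (deg_leM (deg_le_lconstM _ d1) d); lia.
Qed.

Lemma deg_le_fpow_series K : deg_le pr' 0 (fpow_series K).
Proof.
apply: deg_le_sum => k _; apply: deg_le_lconstM.
by have [] := deg_le_inv_fpow b k.+1.
Qed.

Lemma deg_le_inv_var : deg_le pr' 0 z^-1.
Proof. by have [_ _] := zP 0; rewrite rmorph0 subr0. Qed.

Lemma deg_le_inv_subC : deg_le pr' 0 ((z - lconst x)^-1 - z^-1).
Proof.
apply: deg_leD; first by have [] := zP x.
exact: deg_leN deg_le_inv_var.
Qed.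

End LinearVariables.

(** * Formal sums from square partial sums *)

Section FormalSum.
Variable R : comNzRingType.

(* The error made by truncating the double sum at [k, l < K] is small in [u] or
   in [v], but not in both. *)
Definition vanish_above (K : nat) (f : lseries R) :=
  forall p, - K%:Z < p.1 -> - K%:Z < p.2 -> lcoef f p = 0.

Lemma vanish_aboveD K f g : vanish_above K f -> vanish_above K g ->
  vanish_above K (f + g).
Proof. by move=> fK gK p p1 p2; rewrite /= fK// gK// addr0. Qed.

Lemma vanish_above_sum K (I : Type) (r : seq I) (P : pred I) (f : I -> lseries R) :
  (forall i, P i -> vanish_above K (f i)) -> vanish_above K (\sum_(i <- r | P i) f i).
Proof. by move=> fK; apply: big_ind => //; exact: vanish_aboveD. Qed.

Lemma vanish_above_lconstM K c f : vanish_above K f -> vanish_above K (lconst c * f).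
Proof.
by move=> fK p p1 p2; rewrite lcoef_monomM subr0 fK ?mulr0.
Qed.

Lemma vanish_above_fst K f : deg_le fst (- K%:Z) f -> vanish_above K f.
Proof. by move=> fK p p1 _; exact: fK. Qed.

Lemma vanish_above_snd K f : deg_le snd (- K%:Z) f -> vanish_above K f.
Proof. by move=> fK p _ p2; exact: fK. Qed.

Lemma lcoef_sum (I : Type) (r : seq I) (P : pred I) (f : I -> lseries R) p :
  lcoef (\sum_(i <- r | P i) f i) p = \sum_(i <- r | P i) lcoef (f i) p.
Proof. exact: (big_morph (fun f => lcoef f p)). Qed.

(** By the two degree bounds, a given coefficient receives contributions only from [k, l < K] for
    [K] large, and there it agrees with the coefficient of [S]. *)
Lemma is_formal_sum_partial (F : nat -> nat -> lseries R) (S : lseries R) :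
  (forall k l, deg_le fst (- k.+1%:Z) (F k l)) ->
  (forall k l, deg_le snd (- l.+1%:Z) (F k l)) ->
  (forall K, (0 < K)%N ->
    vanish_above K (S - \sum_(0 <= k < K) \sum_(0 <= l < K) F k l)) ->
  is_formal_sum F S.
Proof.
move=> F1 F2 SF p.
have [K [K0 p1K p2K]] : exists K, [/\ (0 < K)%N, - K%:Z < p.1 & - K%:Z < p.2].
  by exists (`|p.1| + `|p.2|).+1; split; lia.
pose s := [seq (k, l) | k <- iota 0 K, l <- iota 0 K].
have us : uniq s by apply: allpairs_uniq; rewrite ?iota_uniq// => -[? ?] [? ?].
have F0 kl : kl \notin s -> lcoef (F kl.1 kl.2) p = 0.
  case: kl => k l /= /allpairsPdep/= skl.
  have [kK|Kk] := ltnP k K; last by apply: F1; rewrite /=; lia.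
  have [lK|Kl] := ltnP l K; last by apply: F2; rewrite /=; lia.
  by case: skl; exists k, l; split; rewrite ?mem_iota.
split.
  apply: (sub_finite_set _ (finite_seq s)) => kl /= /eqP; apply: contra_notT.
  by move/F0.
have -> : (\sum_(kl \in [set: nat * nat]) lcoef (F kl.1 kl.2) p)%classic =
    \sum_(kl <- s) lcoef (F kl.1 kl.2) p.
  rewrite (@bigfs _ _ _ _ s xpredT)//; last by move=> kl _ /F0.
  by apply: eq_fsbigl; apply/seteqP; split.
have /eqP := SF K K0 p p1K p2K; rewrite [lcoef _ _]/= subr_eq0 => /eqP ->.
rewrite big_allpairs lcoef_sum /index_iota subn0; apply: eq_bigr => k _.
exact: lcoef_sum.
Qed.

End FormalSum.

(** * The generating series of the closed form of [P_(k,l)] *)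

Section GeneratingSeries.
Variables (F : fieldType) (n : nat) (x : 'I_n -> F) (b : nat -> F).
Hypothesis injx : injective x.
Hypothesis x_add : forall i j, x i + x j != 0.
Hypothesis b1 : b 1%N = 0.

(** The [c_ij] of the overview; its diagonal is zero, so double sums may run over all pairs. *)
Definition pairP (i j : 'I_n) : F :=
  - (ratioP x i * ratioP x j * (x i - x j) * (x i + x j)^-1).

(** One formula for all [k, l]: [fpow_pos] kills the double sum when an index is 0, and the second
    sum then supplies the one-row function with its sign. For [k, l > 0] the second sum vanishes. *)
Definition P2 (k l : nat) : F :=
  \sum_i \sum_j pairP i j * (fpow_pos b (x i) k * fpow_pos b (x j) l) +
  \sum_i ratioP x i * (fpow_pos b (x i) k *+ (l == 0%N) - fpow_pos b (x i) l *+ (k == 0%N)).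

(** In the expansion at [z = - x_i] the factor [j = i] makes the product zero. *)
Lemma sum_ratioP i : \sum_j 2%:R * x j * ratioP x j * (x i + x j)^-1 = 1.
Proof.
have := @partial_fractions _ _ _ injx F idfun (- x i) => /=.
rewrite (bigD1 i)//= addNr mul0r mul0r => E.
have {}E : 0 = 1 + \sum_j 2%:R * x j * ratioP x j / (- x i - x j).
  by apply: E => j; rewrite -opprD unitfE oppr_eq0.
transitivity (- \sum_j 2%:R * x j * ratioP x j / (- x i - x j)).
  by rewrite -sumrN; apply: eq_bigr => j _; rewrite -opprD invrN mulrN opprK.
by apply/eqP; rewrite eqr_oppLR -addr_eq0 addrC -E.
Qed.

Local Notation u := (lu F).
Local Notation v := (lv F).
Local Notation B := (@lconst F \o b).
Local Notation X := (fun i => lconst (x i)).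

Lemma sum_P2 K : (0 < K)%N ->
  \sum_(0 <= k < K) \sum_(0 <= l < K)
    lconst (P2 k l) / (fpow B u k.+1 * fpow B v l.+1) =
  \sum_i \sum_j lconst (pairP i j) * (fpow_series u b (x i) K * fpow_series v b (x j) K) +
  \sum_i lconst (ratioP x i) * (fpow_series u b (x i) K / v - fpow_series v b (x i) K / u).
Proof.
move=> K0.
have UB z pr pr' k : linear_var pr pr' z -> fpow B z k \is a GRing.unit.
  by move=> zP; apply: fpow_unit => m; case: (zP (b m)).
(* Since [b 1 = 0], an index equal to 0 contributes exactly [u^-1] or [v^-1]. *)
have B1 (z : lseries F) : fpow B z 1 = z by rewrite fpowS fpow0 /= b1 rmorph0 subr0 mul1r.
pose U k := (fpow B u k.+1)^-1; pose V l := (fpow B v l.+1)^-1.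
have U0 : u^-1 = U 0%N by rewrite /U B1.
have V0 : v^-1 = V 0%N by rewrite /V B1.
have UV k l : (fpow B u k.+1 * fpow B v l.+1)^-1 = U k * V l.
  by rewrite mulrC invrM //; [exact: UB (@linear_var_lv F)|exact: UB (@linear_var_lu F)].
have pick0 (f : nat -> lseries F) : \sum_(0 <= l < K) f l *+ (l == 0%N) = f 0%N.
  rewrite (big_ltn K0)/= big_nat_cond big1 ?addr0// => l /andP[/andP[l0 _] _].
  by rewrite -[l == _]negbK -lt0n l0.
under eq_bigr do under eq_bigr do rewrite UV rmorphD mulrDl.
under eq_bigr do rewrite big_split.
rewrite big_split; congr (_ + _).
  under eq_bigr do under eq_bigr do rewrite rmorph_sum mulr_suml.
  under eq_bigr do rewrite exchange_big.
  rewrite exchange_big; apply: eq_bigr => i _ /=.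
  under eq_bigr do under eq_bigr do rewrite rmorph_sum mulr_suml.
  under eq_bigr do rewrite exchange_big.
  rewrite exchange_big; apply: eq_bigr => j _ /=.
  rewrite /fpow_series big_distrlr mulr_sumr; apply: eq_bigr => k _.
  rewrite mulr_sumr; apply: eq_bigr => l _.
  by rewrite !rmorphM /= /U /V; ring.
under eq_bigr do under eq_bigr do rewrite rmorph_sum mulr_suml.
under eq_bigr do rewrite exchange_big.
rewrite exchange_big; apply: eq_bigr => i _ /=.
(* In each one-row term one index is forced to be 0, so its sum collapses to the first term. *)
transitivity (lconst (ratioP x i) * (
   \sum_(0 <= k < K) \sum_(0 <= l < K) (lconst (fpow_pos b (x i) k) * U k * V l) *+ (l == 0%N)
 - \sum_(0 <= k < K) (\sum_(0 <= l < K) (lconst (fpow_pos b (x i) l) * V l * U k)) *+ (k == 0%N))).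
  rewrite -sumrB mulr_sumr; apply: eq_bigr => k _.
  rewrite -sumrMnl -sumrB mulr_sumr; apply: eq_bigr => l _.
  by rewrite rmorphM rmorphB !rmorphMn /=; case: eqP; case: eqP => _ _; rewrite ?mulr1n ?mulr0n; ring.
rewrite pick0; under eq_bigr do rewrite pick0.
by rewrite U0 V0 /fpow_series !mulr_suml.
Qed.

Lemma P2_generating_series : exists S : lseries F,
  is_formal_sum
    (fun k l => lconst (P2 k l) / (fpow B u k.+1 * fpow B v l.+1)) S /\
  let Q z := \prod_(j < n) ((z + lconst (x j)) / (z - lconst (x j))) in
  4%:R * u * v * (u + v) * S =
    u * (Q u + 1) * (- Q v + 1) - v * (- Q u + 1) * (Q v + 1).
Proof.
have uP := @linear_var_lu F; have vP := @linear_var_lv F.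
pose g z i := (z - lconst (x i))^-1 - z^-1.
(* This is the value in [sum_P2] with each [fpow_series] replaced by its limit [g]. *)
exists (\sum_i \sum_j lconst (pairP i j) * (g u i * g v j) +
        \sum_i lconst (ratioP x i) * (g u i / v - g v i / u)); split.
  have UV k l : (fpow B u k.+1 * fpow B v l.+1)^-1 =
      (fpow B u k.+1)^-1 * (fpow B v l.+1)^-1.
    by rewrite mulrC invrM //; apply: fpow_unit => m; [case: (vP (b m)) | case: (uP (b m))].
  apply: is_formal_sum_partial => [k l|k l|K K0].
  - rewrite UV; apply: deg_le_lconstM; rewrite -[- _]addr0.
    by apply: deg_leM; [case: (deg_le_inv_fpow uP b k.+1) | case: (deg_le_inv_fpow vP b l.+1)].
  - rewrite UV; apply: deg_le_lconstM; rewrite -[- _]add0r.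
    by apply: deg_leM; [case: (deg_le_inv_fpow uP b k.+1) | case: (deg_le_inv_fpow vP b l.+1)].
  have Ru i : deg_le fst (- K%:Z) (g u i - fpow_series u b (x i) K).
    by rewrite /g; apply: (deg_le_fpow_series_remainder uP).
  have Rv i : deg_le snd (- K%:Z) (g v i - fpow_series v b (x i) K).
    by rewrite /g; apply: (deg_le_fpow_series_remainder vP).
  rewrite sum_P2// opprD addrACA -!sumrB; apply: vanish_aboveD.
    apply: vanish_above_sum => i _; rewrite -sumrB.
    apply: vanish_above_sum => j _; rewrite -mulrBr; apply: vanish_above_lconstM.
    (* In each summand one factor has degree at most [- K] in some variable, and the other has
       degree at most 0 in that same variable. *)
    have -> : g u i * g v j - fpow_series u b (x i) K * fpow_series v b (x j) K =
        (g u i - fpow_series u b (x i) K) * g v j +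
        fpow_series u b (x i) K * (g v j - fpow_series v b (x j) K) by ring.
    apply: vanish_aboveD.
      apply: vanish_above_fst; rewrite -[- _]addr0; apply: deg_leM (Ru i) _.
      exact: (deg_le_inv_subC vP).
    apply: vanish_above_snd; rewrite -[- _]add0r; apply: deg_leM _ (Rv j).
    exact: (deg_le_fpow_series uP).
  apply: vanish_above_sum => i _; rewrite -mulrBr; apply: vanish_above_lconstM.
  have -> : g u i / v - g v i / u -
      (fpow_series u b (x i) K / v - fpow_series v b (x i) K / u) =
      (g u i - fpow_series u b (x i) K) / v +
      (- (g v i - fpow_series v b (x i) K)) / u by ring.
  apply: vanish_aboveD.
    apply: vanish_above_fst; rewrite -[- _]addr0; apply: deg_leM (Ru i) _.
    exact: (deg_le_inv_var vP).
  apply: vanish_above_snd; rewrite -[- _]addr0; apply: deg_leM (deg_leN (Rv i)) _.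
  exact: (deg_le_inv_var uP).
have UuX i : u - lconst (x i) \is a GRing.unit by case: (uP (x i)).
have UvX i : v - lconst (x i) \is a GRing.unit by case: (vP (x i)).
have QE z : (forall i, z - lconst (x i) \is a GRing.unit) ->
    \prod_(j < n) ((z + lconst (x j)) / (z - lconst (x j))) =
    1 + \sum_i 2%:R * lconst (x i) * lconst (ratioP x i) / (z - lconst (x i)).
  move=> Uz; rewrite (partial_fractions injx (phi := @lconst F))//; congr (_ + _).
  by apply: eq_bigr => i _; rewrite !rmorphM rmorph_nat.
have DP i j : lconst (x i + x j)^-1 * (lconst (x i) + lconst (x j)) = 1.
  by rewrite -rmorphD -rmorphM mulVf ?rmorph1.
have DC i j : lconst (x i + x j)^-1 = lconst (x j + x i)^-1 by rewrite addrC.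
have sumD i : \sum_j 2%:R * lconst (x j) * lconst (ratioP x j) * lconst (x i + x j)^-1 = 1.
  rewrite -[RHS](rmorph1 (@lconst F)) -(sum_ratioP i) rmorph_sum.
  by apply: eq_bigr => j _; rewrite !rmorphM rmorph_nat.
have pairE i j : lconst (pairP i j) = - (lconst (ratioP x i) * lconst (ratioP x j) *
    (lconst (x i) - lconst (x j)) * lconst (x i + x j)^-1).
  by rewrite /pairP rmorphN !rmorphM rmorphB.
cbv beta zeta; under eq_bigr do under eq_bigr do rewrite pairE.
by rewrite (two_variable_identity (linear_var_unit uP) (linear_var_unit vP)
  UuX UvX DP DC sumD (QE u UuX) (QE v UvX)).
Qed.

End GeneratingSeries.

(** * Nonvanishing in the field of rational functions *)

Section RationalFunctions.
Variables (R : realType) (n : nat).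

Lemma ratfun_natr_eq0 m : (m%:R == 0 :> ratfun R n) = (m == 0%N).
Proof.
rewrite -(rmorph_nat (@tofrac {mpoly (complex R)[n]})) tofrac_eq0.
by rewrite -(rmorph_nat (@mpolyC n (complex R))) mpolyC_eq0 pnatr_eq0.
Qed.

Lemma rvar_inj : injective (@rvar R n).
Proof.
move=> i j /eqP; rewrite tofrac_eq => /eqP/(congr1 (mcoeff U_(i))); rewrite !mcoeffXU eqxx.
by case: eqP => [->|_ /eqP]//; rewrite oner_eq0.
Qed.

(** The coefficient of [x_i] is 1, or 2 when [i = j], and is nonzero in characteristic 0. *)
Lemma rvar_add_neq0 i j : @rvar R n i + rvar R j != 0.
Proof.
rewrite -rmorphD tofrac_eq0; apply/eqP => /(congr1 (mcoeff U_(i))).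
rewrite mcoeffD mcoeff0 !mcoeffXU eqxx -natrD => /eqP.
by rewrite pnatr_eq0.
Qed.

End RationalFunctions.

(** In [c_ij] the factor [m = i] of [A_j] cancels [(x_i - x_j) / (x_i + x_j)] up to sign; the
    product over [i < j] defining [schurP] lacks this factor. *)
Lemma mul_ratioC (F : fieldType) (y z A p : F) : y - z != 0 -> y + z != 0 ->
  A * p = - (A * ((z + y) / (z - y) * p) * (y - z) / (y + z)).
Proof.
move=> ns na; have ns' : z - y != 0 by rewrite -opprB oppr_eq0.
by field; rewrite na ns'.
Qed.

(** * Schur P-functions with one and two rows *)

Section TwoRows.
Variables (R : realType) (a : nat -> complex R).

Local Notation b n := (fun m => rcst n (a m)).

Lemma schurP_row k n :
  schurP a [:: k] n = \sum_i ratioP (@rvar R n) i * fpow (b n) (rvar R i) k.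
Proof.
rewrite /schurP; case: n => [|n] /=; first by rewrite big_ord0.
pose f i := ratioP (@rvar R n.+1) i * fpow (b n.+1) (rvar R i) k.
have -> : \sum_(w : 'S_n.+1) ((\prod_(i < n.+1 | (i < 1)%N)
      fpow (b n.+1) (rvar R (w i)) (nth 0%N [:: k] i)) *
     \prod_(i < n.+1 | (i < 1)%N) \prod_(j < n.+1 | (i < j)%N)
        ((rvar R (w i) + rvar R (w j)) / (rvar R (w i) - rvar R (w j)))) =
    \sum_(w : 'S_n.+1) f (w ord0).
  apply: eq_bigr => w _.
  have E1 (G : 'I_n.+1 -> ratfun R n.+1) : \prod_(i < n.+1 | (i < 1)%N) G i = G ord0.
    by apply: big_pred1 => i; rewrite ltnS leqn0.
  rewrite !E1 /= mulrC; congr (_ * _).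
  rewrite /ratioP -(prod_perm_neq w ord0
    (fun m => (rvar R (w ord0) + rvar R m) / (rvar R (w ord0) - rvar R m))).
  by apply: eq_bigl => j; rewrite lt0n.
(* The number of permutations with a given image of the first index cancels the factorial in
   front. *)
rewrite (sum_perm_at ord0 f) card_ord -[X in _ * X]mulr_natl mulKf//.
by rewrite ratfun_natr_eq0 -lt0n fact_gt0.
Qed.

Lemma schurP_two_rows k l n :
  schurP a [:: k; l] n =
    \sum_i \sum_j pairP (@rvar R n) i j *
      (fpow (b n) (rvar R i) k * fpow (b n) (rvar R j) l).
Proof.
have pair0 i : pairP (@rvar R n) i i = 0 by rewrite /pairP subrr mulr0 mul0r oppr0.
have -> : \sum_i \sum_j pairP (@rvar R n) i j *
      (fpow (b n) (rvar R i) k * fpow (b n) (rvar R j) l) =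
    \sum_i \sum_(j | j != i) pairP (@rvar R n) i j *
      (fpow (b n) (rvar R i) k * fpow (b n) (rvar R j) l).
  apply: eq_bigr => i _; rewrite (bigID (fun j => j != i))/= [X in _ + X]big1 ?addr0//.
  by move=> j; rewrite negbK => /eqP ->; rewrite pair0 mul0r.
(* With fewer than two variables [schurP] is 0 by convention, and there are no pairs [i != j]. *)
rewrite /schurP; case: n {pair0} => [|[|n]] /=; first by rewrite big_ord0.
  rewrite big1// => i _; rewrite big1// => j.
  by rewrite (ord1 i) (ord1 j).
pose f i j := pairP (@rvar R n.+2) i j *
  (fpow (b n.+2) (rvar R i) k * fpow (b n.+2) (rvar R j) l).
pose t : 'I_n.+2 := ord0; pose t' : 'I_n.+2 := lift ord0 ord0.
have -> : \sum_(w : 'S_n.+2) ((\prod_(i < n.+2 | (i < 2)%N)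
      fpow (b n.+2) (rvar R (w i)) (nth 0%N [:: k; l] i)) *
     \prod_(i < n.+2 | (i < 2)%N) \prod_(j < n.+2 | (i < j)%N)
        ((rvar R (w i) + rvar R (w j)) / (rvar R (w i) - rvar R (w j)))) =
    \sum_(w : 'S_n.+2) f (w t) (w t').
  apply: eq_bigr => w _.
  have E2 (G : 'I_n.+2 -> ratfun R n.+2) : \prod_(i < n.+2 | (i < 2)%N) G i = G t * G t'.
    rewrite (bigD1 t)//= (big_pred1 t')// => -[[|[|i]] Hi]//.
  rewrite !E2 [nth _ _ t]/= [nth _ _ t']/= mulrC /f /pairP; congr (_ * _).
  pose r i j := (rvar R i + rvar R j) / (@rvar R n.+2 i - rvar R j).
  have -> : \prod_(j < n.+2 | (t < j)%N) r (w t) (w j) = ratioP (@rvar R n.+2) (w t).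
    rewrite /ratioP -(prod_perm_neq w t (r (w t))).
    by apply: eq_bigl => j; rewrite lt0n.
  have -> : ratioP (@rvar R n.+2) (w t') =
      r (w t') (w t) * \prod_(j < n.+2 | (t' < j)%N) r (w t') (w j).
    rewrite /ratioP -(prod_perm_neq w t' (r (w t'))) (bigD1 t)//=; congr (_ * _).
    by apply: eq_bigl => -[[|[|j]] Hj].
  have ns : rvar R (w t) - rvar R (w t') != 0.
    by rewrite subr_eq0 (inj_eq (@rvar_inj R _)) (inj_eq perm_inj).
  have na := rvar_add_neq0 R (w t) (w t').
  rewrite /r; exact: (mul_ratioC _ _ ns na).
rewrite (sum_perm_at2 f)// card_ord -[X in _ * X]mulr_natl mulKf//.
by rewrite ratfun_natr_eq0 -lt0n fact_gt0.
Qed.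

Lemma P2_antisym (F : fieldType) n (x : 'I_n -> F) b k l : P2 x b k l = - P2 x b l k.
Proof.
rewrite /P2 opprD; congr (_ + _).
  rewrite exchange_big -sumrN; apply: eq_bigr => i _; rewrite -sumrN.
  apply: eq_bigr => j _; rewrite -mulNr [X in _ = _ * X]mulrC; congr (_ * _).
  by rewrite /pairP (addrC (x j) (x i)); ring.
by rewrite -sumrN; apply: eq_bigr => i _; rewrite -mulrN opprB.
Qed.

Lemma schurP2E k l n : schurP2 a k l n = P2 (@rvar R n) (b n) k l.
Proof.
have lt m p : (p < m)%N ->
    schurP a (if p == 0%N then [:: m] else [:: m; p]) n = P2 (@rvar R n) (b n) m p.
  move=> pm; have m0 : m != 0%N by rewrite -lt0n; apply: leq_ltn_trans pm.
  rewrite /P2 /fpow_pos (negPf m0); case: eqP => [p0|_].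
    rewrite schurP_row [X in _ = X + _]big1 ?add0r => [|i _]; last by rewrite big1// => j _; rewrite !mulr0.
    by apply: eq_bigr => i _; rewrite mulr1n mulr0n subr0.
  rewrite schurP_two_rows [X in _ = _ + X]big1 ?addr0// => i _.
  by rewrite !mulr0n subrr mulr0.
rewrite /schurP2; case: (ltngtP l k) => [lk|kl|->]; first exact: lt.
  by rewrite P2_antisym lt.
(* On the diagonal skew-symmetry gives [2 P2 = 0], and 2 is nonzero in the field. *)
have /eqP := P2_antisym (@rvar R n) (b n) k k.
rewrite -addr_eq0 -mulr2n -mulr_natl mulf_eq0 ratfun_natr_eq0/=.
by move/eqP.
Qed.

End TwoRows.

Theorem theorem8p4 (R : realType) (a : nat -> complex R) (ha : a 1%N = 0)
    (n : nat) :
  let u := lu (ratfun R n) in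
  let v := lv (ratfun R n) in
  let b := fun m : nat => lconst (rcst n (a m)) in
  exists S : lseries (ratfun R n),
    is_formal_sum
      (fun k l : nat =>
         lconst (schurP2 a k l n) / (fpow b u k.+1 * fpow b v l.+1)) S /\
    4%:R * u * v * (u + v) * S =
      u * (genQ u + 1) * (- genQ v + 1) - v * (- genQ u + 1) * (genQ v + 1).
Proof.
move=> u v b.
have b1 : rcst n (a 1%N) = 0 by rewrite /rcst ha mpolyC0 rmorph0.
have [S [SE QE]] := @P2_generating_series _ _ _ (fun m => rcst n (a m))
  (@rvar_inj R n) (@rvar_add_neq0 R n) b1.
exists S; split=> // p; have [fin ->] := SE p.
split; last by apply: eq_fsbigr => kl _; rewrite schurP2E.
by apply: sub_finite_set fin => kl /=; rewrite schurP2E.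
Qed.
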